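(* Let $B$ be a commutative monoid, written additively, such that for all $x,y,u,v\in B$ with $x+y=u+v$ there exists $z\in B$ such that either ($x+z=u$ and $z+v=y$) or ($x=u+z$ and $v=z+y$). Let $s(B)$ be its symmetrization (which is then a hypergroup) and $i:B\to s(B)$, $b\mapsto(b,1)$. Then the following conditions are equivalent: (1) $s(B)$ is a group; (2) $s(B)$ is the group given by the Grothendieck construction applied to $B$, up to unique isomorphism (i.e. $s(B)$ is a group and, together with $i$, it is the Grothendieck group of $B$ with its canonical map from $B$, up to unique isomorphism); (3) $B$ is cancellative, i.e. for all $x,y,a\in B$, $x+a=y+a$ implies $x=y$.
   Context: Hypergroup (meaning canonical hypergroup): a set $H$ with an element $0\in H$ and a map $+:H\times H\to \mathcal P(H)^*$, where $\mathcal P(H)^*$ is the set of non-empty subsets of $H$, such that, with $A+A':=\bigcup_{a\in A,a'\in A'}(a+a')$ for subsets $A,A'\subseteq H$ and elements identified with singletons: (1) $x+y=y+x$; (2) $(x+y)+z=x+(y+z)$; (3) $0+x=x=x+0$; (4) for every $x\in H$ there is a unique $y\in H$, denoted $-x$, with $0\in x+y$; (5) $x\in y+z$ implies $z\in x-y:=x+(-y)$. A hypergroup is a group if every sum $x+y$ is a singleton (it is then an abelian group under the resulting operation). Symmetrization: $s(B)$ is the quotient of $B\times\{-1,1\}$ by the equivalence relation which identifies $(a,1)\sim(b,-1)$ whenever $a+b=0$ in $B$ (classes are written by representatives). Its hypersum is the commutative operation, with values in subsets of $s(B)$, given by $(a,1)+(b,1)=\{(a+b,1)\}$, $(a,-1)+(b,-1)=\{(a+b,-1)\}$,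 $(a,1)+(b,-1)=\{(z,1): z\in B,\ z+b=a\}\cup\{(z,-1): z\in B,\ z+a=b\}$; this is compatible with the equivalence relation. Its neutral element is the class $(0,1)=(0,-1)$. Under the hypothesis made on $B$, $s(B)$ is a hypergroup. *)

(* Defs.v *)
From HB Require Import structures.
From mathcomp Require Import all_boot all_algebra.
From mathcomp Require Import boolp classical_sets.

Set Implicit Arguments.
Unset Strict Implicit.
Unset Printing Implicit Defensive.

Import GRing.Theory.
Local Open Scope ring_scope.
Local Open Scope quotient_scope.
Local Open Scope classical_set_scope.

(** * Canonical hypergroups *)

Definition setsum (T : Type) (add : T -> T -> set T) (A A' : set T) : set T :=
  \bigcup_(a in A) \bigcup_(a' in A') add a a'.

(* [hadd_opp] and [hopp_unique] say that [hopp x] is the unique [y] such that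
   [0] belongs to [x + y]. *)
Record hypergroup := Hypergroup {
  hcarrier :> Type;
  hzero : hcarrier;
  hopp : hcarrier -> hcarrier;
  hadd : hcarrier -> hcarrier -> set hcarrier;
  hadd_neq0 : forall x y, hadd x y !=set0;
  haddC : forall x y, hadd x y = hadd y x;
  haddA : forall x y z,
    setsum hadd (hadd x y) [set z] = setsum hadd [set x] (hadd y z);
  hadd0l : forall x, hadd hzero x = [set x];
  hadd0r : forall x, hadd x hzero = [set x];
  hadd_opp : forall x, hadd x (hopp x) hzero;
  hopp_unique : forall x y, hadd x y hzero -> y = hopp x;
  hadd_rev : forall x y z, hadd y z x -> hadd x (hopp y) z
}.

Definition is_group (H : hypergroup) : Prop :=
  forall x y : H, exists z : H, hadd x y = [set z].

Definition is_hyperiso (H K : hypergroup) (f : H -> K) : Prop :=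
  [/\ bijective f, f (hzero H) = hzero K
    & forall x y : H, f @` hadd x y = hadd (f x) (f y)].

Section GroupHypergroup.
Variable G : zmodType.

Let gadd (x y : G) : set G := [set x + y].

Fact gadd_neq0 x y : gadd x y !=set0. Proof. by exists (x + y). Qed.

Fact gaddC x y : gadd x y = gadd y x. Proof. by rewrite /gadd addrC. Qed.

Fact gaddA x y z :
  setsum gadd (gadd x y) [set z] = setsum gadd [set x] (gadd y z).
Proof. by rewrite /setsum /gadd !bigcup_set1 addrA. Qed.

Fact gadd0l x : gadd 0 x = [set x]. Proof. by rewrite /gadd add0r. Qed.

Fact gadd0r x : gadd x 0 = [set x]. Proof. by rewrite /gadd addr0. Qed.

Fact gadd_opp x : gadd x (- x) 0. Proof. by rewrite /gadd /= subrr. Qed.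

Fact gopp_unique x y : gadd x y 0 -> y = - x.
Proof. by rewrite /gadd /= => /esym/eqP; rewrite addrC addr_eq0 => /eqP. Qed.

Fact gadd_rev x y z : gadd y z x -> gadd x (- y) z.
Proof. by rewrite /gadd /= => ->; rewrite addrC addKr. Qed.

Definition group_hypergroup : hypergroup :=
  Hypergroup gadd_neq0 gaddC gaddA gadd0l gadd0r gadd_opp gopp_unique gadd_rev.

End GroupHypergroup.

(** * Symmetrization *)

Section Symmetrization.
Variable B : nmodType.

(* In [B * bool], [true] stands for the sign [1] and [false] for [-1]. *)
Definition symz_rel : rel (B * bool) :=
  fun p q => (p == q) || ((p.2 != q.2) && (p.1 + q.1 == 0)).

Fact symz_rel_refl : reflexive symz_rel.
Proof. by move=> p; rewrite /symz_rel eqxx. Qed.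

Fact symz_rel_sym : symmetric symz_rel.
Proof. by move=> p q; rewrite /symz_rel eq_sym addrC (eq_sym p.2). Qed.

Fact symz_rel_trans : transitive symz_rel.
Proof.
move=> q p r /orP[/eqP-> //|/andP[npq /eqP pq0]].
case/orP=> [/eqP<-|/andP[nqr /eqP qr0]]; apply/orP.
  by right; rewrite npq pq0 eqxx.
left; case: p q r npq pq0 nqr qr0 => [a s] [b t] [c u] /= nst ab0 ntu bc0.
rewrite xpair_eqE; apply/andP; split; last by case: s t u nst ntu => [] [] [].
by rewrite -[a]addr0 -bc0 addrA ab0 add0r.
Qed.

(* [symz_rel] is the equivalence relation generated by the identifications
   [(a, 1) ~ (b, -1)] for [a + b = 0]. *)
Lemma symz_rel_least (e : equiv_rel (B * bool)) :
  (forall a b : B, a + b = 0 -> e (a, true) (b, false)) ->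
  forall p q, symz_rel p q -> e p q.
Proof.
move=> eP [a s] [b t] /orP[/eqP -> //|/andP[/= nst /eqP ab0]].
case: s t nst => [] [] // _; first exact: eP.
by rewrite equiv_sym; apply: eP; rewrite addrC.
Qed.

Definition symz_equiv : equiv_rel (B * bool) :=
  EquivRel symz_rel symz_rel_refl symz_rel_sym symz_rel_trans.

Definition symz : Type := {eq_quot symz_equiv}.

Definition symz_class (p : B * bool) : symz :=
  \pi_({eq_quot symz_equiv}) p.

Definition symz_in (b : B) : symz := symz_class (b, true).

Definition symz_zero : symz := symz_class (0, true).

Definition symz_mixed_add (a b : B) : set symz :=
  [set symz_class (z, true) | z in [set z | z + b = a]] `|`
  [set symz_class (z, false) | z in [set z | z + a = b]].

Definition symz_rep_add (p q : B * bool) : set symz :=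
  match p, q with
  | (a, true), (b, true) => [set symz_class (a + b, true)]
  | (a, false), (b, false) => [set symz_class (a + b, false)]
  | (a, true), (b, false) | (b, false), (a, true) => symz_mixed_add a b
  end.

(* By [symz_addE] the choice of representatives is irrelevant. *)
Definition symz_add (x y : symz) : set symz := symz_rep_add (repr x) (repr y).

Definition symz_opp (x : symz) : symz :=
  let p := repr x in symz_class (p.1, ~~ p.2).

Lemma symz_classP p q : symz_class p = symz_class q <-> symz_rel p q.
Proof. by split=> [/eqmodP //|pq]; exact/eqmodP. Qed.

Lemma symz_class_repr (x : symz) : symz_class (repr x) = x.
Proof. exact: reprK. Qed.

Lemma symz_zeroE : symz_zero = symz_class (0, false).
Proof. by apply/symz_classP; rewrite /symz_rel /= addr0 eqxx orbT. Qed.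

Local Definition pos (p : B * bool) : B := if p.2 then p.1 else 0.
Local Definition neg (p : B * bool) : B := if p.2 then 0 else p.1.

Local Lemma symz_classE p q :
  symz_class p = symz_class q <-> pos p + neg q = neg p + pos q.
Proof.
rewrite symz_classP /symz_rel /pos /neg.
case: p q => [a []] [b []] /=;
  rewrite xpair_eqE /= ?andbT ?andbF ?orbF /= ?addr0 ?add0r.
- by split=> /eqP.
- by split=> /eqP.
- by split=> [/eqP|/esym/eqP].
- by split=> [/eqP->|->].
Qed.

Local Lemma symz_rep_addE p q r : symz_rep_add p q (symz_class r) <->
  pos p + pos q + neg r = neg p + neg q + pos r.
Proof.
have mixed a b : symz_mixed_add a b (symz_class r) <-> a + neg r = b + pos r.
  rewrite /symz_mixed_add; split; last first.
    case: r => c []; rewrite /neg /pos /= addr0.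
      by move=> ->; left; exists c => //=; rewrite addrC.
    by move=> <-; right; exists c => //=; rewrite addrC.
  case=> -[z /= <-] /symz_classE; case: r => c [];
    rewrite /pos /neg /= ?addr0 ?add0r.
  - by move=> ->; rewrite addrC.
  - by move=> zc; rewrite [z + b]addrC -addrA zc addr0.
  - by move=> zc; rewrite [z + a]addrC -addrA -zc addr0.
  - by move=> ->; rewrite addrC.
case: p q => [a []] [b []] /=.
- by split=> [/esym/symz_classE|e]; [|apply/esym/symz_classE; move: e];
     rewrite /pos /neg /= ?addr0 ?add0r.
- by rewrite mixed /pos /neg /= ?addr0 ?add0r.
- by rewrite mixed /pos /neg /= ?addr0 ?add0r.
- by split=> [/esym/symz_classE|e]; [|apply/esym/symz_classE; move: e];
     rewrite /pos /neg /= ?addr0 ?add0r.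
Qed.

Local Lemma symz_rep_addC p q : symz_rep_add p q = symz_rep_add q p.
Proof. by case: p q => [a []] [b []] //=; rewrite addrC. Qed.

Local Lemma symz_rep_add_compatl p p' q :
  symz_class p = symz_class p' -> symz_rep_add p q = symz_rep_add p' q.
Proof.
move=> /symz_classP/orP[/eqP-> //|/andP[npp pp0]].
have addNK (a b x : B) : a + b = 0 -> a + (b + x) = x.
  by move=> ab0; rewrite addrA ab0 add0r.
apply/seteqP; split=> x; rewrite -(symz_class_repr x) !symz_rep_addE;
  case: p p' npp pp0 => [a []] [b []] //= _ /eqP ab0;
  rewrite /pos /neg /= !add0r -!addrA => e.
- by rewrite -e addNK // addrC.
- by rewrite e addNK // addrC.
- by rewrite e addNK.
- by rewrite -e addNK.
Qed.

Lemma symz_addE p q :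
  symz_add (symz_class p) (symz_class q) = symz_rep_add p q.
Proof.
rewrite /symz_add (symz_rep_add_compatl _ (symz_class_repr _)).
by rewrite symz_rep_addC (symz_rep_add_compatl _ (symz_class_repr _)) symz_rep_addC.
Qed.

Lemma symz_oppE p : symz_opp (symz_class p) = symz_class (p.1, ~~ p.2).
Proof.
have := symz_class_repr (symz_class p); rewrite /symz_opp.
case: (repr _) => a s; case: p => b t /symz_classE e; apply/symz_classE; move: e.
by rewrite /pos /neg; case: s t => [] [] /=; rewrite ?add0r ?addr0 => ->.
Qed.

Local Lemma symz_addP p q r :
  symz_add (symz_class p) (symz_class q) (symz_class r) <->
  pos p + pos q + neg r = neg p + neg q + pos r.
Proof. by rewrite symz_addE symz_rep_addE. Qed.

Local Lemma symz_ind (P : symz -> Prop) :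
  (forall p, P (symz_class p)) -> forall x, P x.
Proof. by move=> Pc x; rewrite -(symz_class_repr x). Qed.

Fact symz_addC x y : symz_add x y = symz_add y x.
Proof. exact: symz_rep_addC. Qed.

Fact symz_add0l x : symz_add symz_zero x = [set x].
Proof.
elim/symz_ind: x => p; apply/seteqP; split; elim/symz_ind=> q.
  move=> /symz_addP; rewrite {1 3}/pos {2}/neg /= !add0r => e.
  by apply/esym/symz_classE.
move=> /esym/symz_classE e; apply/symz_addP.
by rewrite {1 3}/pos {2}/neg /= !add0r.
Qed.

Fact symz_add0r x : symz_add x symz_zero = [set x].
Proof. by rewrite symz_addC symz_add0l. Qed.

Fact symz_add_opp x : symz_add x (symz_opp x) symz_zero.
Proof.
elim/symz_ind: x => -[a s]; rewrite symz_oppE; apply/symz_addP.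
by rewrite /pos /neg; case: s; rewrite /= ?addr0 ?add0r.
Qed.

Fact symz_opp_unique x y : symz_add x y symz_zero -> y = symz_opp x.
Proof.
elim/symz_ind: x => -[a s]; elim/symz_ind: y => -[b t] /symz_addP.
rewrite symz_oppE => e; apply/symz_classE; move: e.
rewrite /pos /neg; case: s t => [] [] /=; rewrite ?addr0 ?add0r // addrC => -> //.
Qed.

Fact symz_add_rev x y z : symz_add y z x -> symz_add x (symz_opp y) z.
Proof.
elim/symz_ind: x => p; elim/symz_ind: y => q; elim/symz_ind: z => r.
rewrite symz_oppE => /symz_addP e; apply/symz_addP; move: e.
have -> : pos (q.1, ~~ q.2) = neg q by rewrite /pos /neg /=; case: q.2.
have -> : neg (q.1, ~~ q.2) = pos q by rewrite /pos /neg /=; case: q.2.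
by move=> e; rewrite [LHS](ACl (2*3*1))/= -e [LHS](ACl (3*1*2))/=.
Qed.

Section Hypergroup.
Hypothesis hB : forall x y u v : B, x + y = u + v ->
  exists z : B, (x + z = u /\ z + v = y) \/ (x = u + z /\ v = z + y).

Fact symz_add_neq0 x y : symz_add x y !=set0.
Proof.
have mixed (a b : B) : symz_mixed_add a b !=set0.
  have [z [[az zb]|[az zb]]] := hB (addrC a b).
    by exists (symz_class (z, false)); right; exists z; rewrite //= addrC.
  by exists (symz_class (z, true)); left; exists z; rewrite //= addrC.
rewrite /symz_add; case: (repr x) (repr y) => [a []] [b []] //=.
  by exists (symz_class (a + b, true)).
by exists (symz_class (a + b, false)).
Qed.

Local Lemma symz_add3P p q r t :
  setsum symz_add (symz_add (symz_class p) (symz_class q))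
                  [set symz_class r] (symz_class t) <->
  pos p + pos q + pos r + neg t = neg p + neg q + neg r + pos t.
Proof.
split=> [[]|].
  elim/symz_ind=> -[c s] /symz_addP e1 [_ -> /symz_addP]; move: e1.
  rewrite /pos /neg; case: s => /=; rewrite ?addr0 ?add0r => e1 e2.
    by rewrite e1 -addrA -[LHS]addrA [c + _]addrA e2 !addrA.
  by rewrite -addrA -[RHS]addrA e2 -e1 !addrA.
have intro (s : B * bool) : pos p + pos q + neg s = neg p + neg q + pos s ->
    pos s + pos r + neg t = neg s + neg r + pos t ->
    setsum symz_add (symz_add (symz_class p) (symz_class q))
                  [set symz_class r] (symz_class t).
  move=> e1 e2; exists (symz_class s); first exact/symz_addP.
  by exists (symz_class r) => //; apply/symz_addP.
(* the case where [p] and [q] have opposite signs, with values [a] and [b] *)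
have mixed (a b : B) : a + pos r + neg t = b + neg r + pos t ->
    exists2 s : B * bool, a + neg s = b + pos s
      & pos s + pos r + neg t = neg s + neg r + pos t.
  case: r t {intro} => [c s3] [d s4].
  rewrite /pos /neg; case: s3 s4 => [] [] /=; rewrite ?addr0.
  - case/hB=> z [[az zd]|[az dz]].
      by exists (z, false); rewrite /= ?addr0 ?add0r.
    by exists (z, true); rewrite /= ?addr0 ?add0r.
  - by exists (c + d, false); rewrite /= ?addr0 ?add0r ?addrA.
  - by exists (c + d, true); rewrite /= ?addr0 ?add0r ?addrA.
  - case/hB=> z [[az zc]|[az cz]].
      by exists (z, false); rewrite /= ?addr0 ?add0r.
    by exists (z, true); rewrite /= ?addr0 ?add0r.
case: p q intro => [a s1] [b s2]; rewrite {1 2 5 6}/pos {1 2 5 6}/neg.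
case: s1 s2 => [] [] /= intro; rewrite ?addr0 ?add0r.
- by move=> e; apply: (intro (a + b, true)); rewrite ?addr0 ?add0r.
- by case/mixed=> s e1 e2; apply: (intro s); rewrite ?addr0 ?add0r.
- by case/mixed=> s e1 e2; apply: (intro s); rewrite ?addr0 ?add0r.
- by move=> e; apply: (intro (a + b, false)); rewrite ?addr0 ?add0r.
Qed.

Fact symz_addA x y z : setsum symz_add (symz_add x y) [set z] =
  setsum symz_add [set x] (symz_add y z).
Proof.
have setsumC A A' : setsum symz_add A A' = setsum symz_add A' A.
  by apply/seteqP; split=> t [a aA [b bA abt]]; exists b => //; exists a => //;
    rewrite symz_addC.
rewrite [RHS]setsumC.
elim/symz_ind: x => p; elim/symz_ind: y => q; elim/symz_ind: z => r.
apply/seteqP; split; elim/symz_ind=> t /symz_add3P e; apply/symz_add3P.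
  by rewrite [LHS](ACl (3*1*2*4))/= e [LHS](ACl (2*3*1*4))/=.
by rewrite [LHS](ACl (2*3*1*4))/= e [LHS](ACl (3*1*2*4))/=.
Qed.

Definition symz_hypergroup : hypergroup :=
  Hypergroup symz_add_neq0 symz_addC symz_addA symz_add0l symz_add0r
    symz_add_opp symz_opp_unique symz_add_rev.

End Hypergroup.

End Symmetrization.

(** * Grothendieck construction *)

Section Grothendieck.
Variable B : nmodType.

(* The pair [(a, b)] represents the formal difference [a - b]. *)
Definition groth_rel : rel (B * B) :=
  fun p q => `[< exists k : B, p.1 + q.2 + k = q.1 + p.2 + k >].

Fact groth_rel_refl : reflexive groth_rel.
Proof. by move=> p; apply/asboolP; exists 0. Qed.

Fact groth_rel_sym : symmetric groth_rel.
Proof.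
by move=> p q; apply/idP/idP=> /asboolP[k e]; apply/asboolP; exists k.
Qed.

Fact groth_rel_trans : transitive groth_rel.
Proof.
move=> [c d] [a b] [e f] /asboolP[k /= ek] /asboolP[l /= el].
apply/asboolP; exists (c + d + k + l) => /=.
rewrite [LHS](AC (2*4) ((1*4*5)*(3*2*6))) /= ek el.
by rewrite [LHS](AC (3*3) ((4*2)*(1*5*3*6))).
Qed.

Definition groth_equiv : equiv_rel (B * B) :=
  EquivRel groth_rel groth_rel_refl groth_rel_sym groth_rel_trans.

Definition groth : Type := {eq_quot groth_equiv}.
HB.instance Definition _ := Choice.on groth.

Definition groth_class (p : B * B) : groth := \pi_({eq_quot groth_equiv}) p.

Definition groth_zero : groth := groth_class (0, 0).

(* By [groth_addE] and [groth_oppE] the choice of representatives is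
   irrelevant. *)
Definition groth_add (x y : groth) : groth :=
  let p := repr x in let q := repr y in groth_class (p.1 + q.1, p.2 + q.2).

Definition groth_opp (x : groth) : groth :=
  let p := repr x in groth_class (p.2, p.1).

Definition groth_in (b : B) : groth := groth_class (b, 0).

Lemma groth_classP p q : groth_class p = groth_class q <->
  exists k : B, p.1 + q.2 + k = q.1 + p.2 + k.
Proof.
split=> [/eqmodP /asboolP //|pq].
by apply/eqmodP; apply/asboolP.
Qed.

Lemma groth_class_repr (x : groth) : groth_class (repr x) = x.
Proof. exact: reprK. Qed.

Lemma groth_addE p q : groth_add (groth_class p) (groth_class q) =
  groth_class (p.1 + q.1, p.2 + q.2).
Proof.
have := groth_class_repr (groth_class p).
have := groth_class_repr (groth_class q); rewrite /groth_add.
move: (repr (_ q)) (repr (_ p)) => q' p' /groth_classP[k ek] /groth_classP[l el].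
apply/groth_classP.
exists (k + l); rewrite /= [LHS](AC (2*2*2) ((1*3*6)*(2*4*5))) /= el ek.
by rewrite [LHS](AC (3*3) ((1*4)*(2*5)*(6*3))).
Qed.

Lemma groth_oppE p : groth_opp (groth_class p) = groth_class (p.2, p.1).
Proof.
have := groth_class_repr (groth_class p).
rewrite /groth_opp; case: (repr _) => a b; case: p => c d /groth_classP[k /= ek].
by apply/groth_classP; exists k; rewrite /= [b + c]addrC -ek [a + d]addrC.
Qed.

Local Lemma groth_ind (P : groth -> Prop) :
  (forall p, P (groth_class p)) -> forall x, P x.
Proof. by move=> Pc x; rewrite -(groth_class_repr x). Qed.

Fact groth_addA : associative groth_add.
Proof.
elim/groth_ind=> p; elim/groth_ind=> q; elim/groth_ind=> r.
by rewrite !groth_addE /= !addrA.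
Qed.

Fact groth_addC : commutative groth_add.
Proof.
elim/groth_ind=> p; elim/groth_ind=> q.
by rewrite !groth_addE [q.1 + _]addrC [q.2 + _]addrC.
Qed.

Fact groth_add0 : left_id groth_zero groth_add.
Proof. by elim/groth_ind=> -[a b]; rewrite groth_addE /= !add0r. Qed.

Fact groth_addN : left_inverse groth_zero groth_opp groth_add.
Proof.
elim/groth_ind=> -[a b]; rewrite groth_oppE groth_addE /=.
by apply/groth_classP; exists 0; rewrite /= !addr0 add0r addrC.
Qed.

HB.instance Definition _ :=
  GRing.isZmodule.Build groth groth_addA groth_addC groth_add0 groth_addN.

End Grothendieck.

(* Main.v *)
Require Import Defs.
From mathcomp Require Import all_boot all_algebra.
From mathcomp Require Import boolp classical_sets.

Import GRing.Theory.
Local Open Scope ring_scope.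

(** Sending [(a, 1)] to [a] and [(b, -1)] to [- b] defines a map from [s(B)] to
the Grothendieck group which turns [z \in x + y] into an equality, whatever [B]
is, and which is onto because [(a, 1) + (b, -1)] is never empty. When [B] is
cancellative it is also injective, so that sums in [s(B)] are singletons.
Conversely, if [x + a = y + a], then both [(x, 1)] and [(y, 1)] lie in
[(x + a, 1) + (a, -1)], so they agree as soon as [s(B)] is a group. *)

Local Notation pos := Defs.pos.
Local Notation neg := Defs.neg.

Definition cancellative (B : nmodType) : Prop :=
  forall x y a : B, x + a = y + a -> x = y.

(** The pair [(pos p, neg p)] stands for the formal difference [pos p - neg p]; [symz_grothE] makes
    the choice of [repr] harmless. *)
Definition symz_groth {B : nmodType} (x : symz B) : groth B :=
  let p := repr x in groth_class (pos p, neg p).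

Lemma symz_grothE {B : nmodType} (p : B * bool) :
  symz_groth (symz_class p) = groth_class (pos p, neg p).
Proof.
have /Defs.symz_classE e := symz_class_repr (symz_class p).
(* Equality in [symz] is an exact equation between sums, so the stabilizing term can be [0]. *)
by apply/groth_classP; exists 0; rewrite /= e [pos p + _]addrC.
Qed.

Lemma symz_groth_in {B : nmodType} (b : B) :
  symz_groth (symz_in b) = groth_in b.
Proof. exact: symz_grothE. Qed.

Lemma symz_groth_add {B : nmodType} {x y z : symz B} :
  symz_add x y z -> symz_groth z = symz_groth x + symz_groth y.
Proof.
elim/Defs.symz_ind: x => p; elim/Defs.symz_ind: y => q.
elim/Defs.symz_ind: z => r /Defs.symz_addP e.
rewrite !symz_grothE [RHS]groth_addE /=.
by apply/groth_classP; exists 0; rewrite /= e [pos r + _]addrC.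
Qed.

(** Classes in [groth B] agree up to a common summand [k]; cancelling it leaves the criterion
    [symz_classE] for equality in [symz]. *)
Lemma symz_groth_inj {B : nmodType} :
  cancellative B -> injective (@symz_groth B).
Proof.
move=> cB; elim/Defs.symz_ind=> p; elim/Defs.symz_ind=> q.
rewrite !symz_grothE => /groth_classP[k /= /cB e].
by apply/Defs.symz_classE; rewrite e addrC.
Qed.

Section SymmetrizationGroup.
Variable B : nmodType.
Hypothesis hB : forall x y u v : B, x + y = u + v ->
  exists z : B, (x + z = u /\ z + v = y) \/ (x = u + z /\ v = z + y).

Local Notation sB := (symz_hypergroup hB).

Lemma symz_group_cancellative : is_group sB -> cancellative B.
Proof.
move=> gB x y a xy.
have mem c : c + a = x + a ->
    hadd (symz_in (x + a) : sB) (symz_class (a, false)) (symz_in c).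
  move=> ca; apply/Defs.symz_addP.
  by rewrite /Defs.pos /Defs.neg /= !addr0 add0r [a + _]addrC.
have [z ez] := gB (symz_in (x + a)) (symz_class (a, false)).
have : symz_in x = symz_in y.
  move: (mem x erefl) (mem y (esym xy)); rewrite ez.
  by move=> /= xz yz; rewrite xz yz.
by move/Defs.symz_classE; rewrite /Defs.pos /Defs.neg /= addr0 add0r.
Qed.

Lemma cancellative_symz_group : cancellative B -> is_group sB.
Proof.
move=> cB x y; have [z xyz] := hadd_neq0 x y; exists z.
apply/seteqP; split=> [t xyt|t /= -> //]; apply: symz_groth_inj => //.
by rewrite (symz_groth_add xyz) (symz_groth_add xyt).
Qed.

Lemma symz_groth_surj (g : groth B) : exists x : sB, symz_groth x = g.
Proof.
elim/Defs.groth_ind: g => -[a b].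
have [x xab] := hadd_neq0 (symz_in a : sB) (symz_class (b, false)).
exists x; rewrite (symz_groth_add xab) symz_groth_in symz_grothE.
by rewrite [LHS]groth_addE /= addr0 add0r.
Qed.

Lemma symz_groth_hyperiso :
  is_group sB -> is_hyperiso (symz_groth : sB -> group_hypergroup (groth B)).
Proof.
move=> gB; have cB := symz_group_cancellative gB; split.
(* Surjectivity gives a right inverse [g], and injectivity makes it a left inverse too. *)
- have [g gK] := choice symz_groth_surj.
  by exists g => // x; apply: symz_groth_inj.
- exact: symz_groth_in.
(* Both sides are singletons, so it suffices to compare their elements by [symz_groth_add]. *)
- move=> x y; have [z xyz] := gB x y; rewrite xyz image_set1.
  have /symz_groth_add -> // : hadd x y z by rewrite xyz.
Qed.

(* The class [(b, -1)] is the opposite of [i b], so a morphism is determined by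
   its values on [i]. *)
Lemma symz_morph_eq (H : hypergroup) (f g : sB -> H) :
  is_hyperiso f -> is_hyperiso g ->
  (forall b, f (symz_in b) = g (symz_in b)) -> f = g.
Proof.
move=> fI gI fg; apply/funext; elim/Defs.symz_ind=> -[b []]; first exact: fg.
have oppE (h : sB -> H) : is_hyperiso h ->
      h (symz_class (b, false)) = hopp (h (symz_in b)).
  (* The map [h] carries the zero in [i b + (b, -1)] to the zero of [H], where opposites are
     unique. *)
  move=> [_ h0 hD]; apply: hopp_unique; rewrite -hD -h0.
  exists (hzero sB) => //.
  by have := hadd_opp (symz_in b : sB); rewrite /= symz_oppE.
by rewrite !oppE // fg.
Qed.

End SymmetrizationGroup.

Theorem proposition5p3 (B : nmodType)
    (hB : forall x y u v : B, x + y = u + v ->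
       exists z : B, (x + z = u /\ z + v = y) \/ (x = u + z /\ v = z + y)) :
  let sB := symz_hypergroup hB in
  [<-> is_group sB;
       is_group sB /\
       exists! f : sB -> group_hypergroup (groth B),
         is_hyperiso f /\ (forall b : B, f (symz_in b) = groth_in b);
       forall x y a : B, x + a = y + a -> x = y].
Proof.
move=> sB; split=> [gB|].
  split=> //; exists symz_groth; have fI := symz_groth_hyperiso _ hB gB.
  split=> [|g [gI gin]]; first by split=> // b; exact: symz_groth_in.
  by apply: symz_morph_eq => // b; rewrite gin; exact: symz_groth_in.
split=> [[gB _]|]; first exact: symz_group_cancellative.
exact: cancellative_symz_group.
Qed.
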